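(* There exist infinitely many primes $p$ for which there exists $a\in(\mathbb{Z}/5p\mathbb{Z})^*$ such that $a\bmod p$ generates $(\mathbb{Z}/p\mathbb{Z})^*$, $a^{(p-1)/2}\equiv-1\pmod{5p}$, and $S=S_{5p}(a)$ satisfies $|S\cap(S+1)|\equiv-2\pmod 5$.
   Context: $S_{pq}(a)=\{a^j:0\le j<p-1\}\subseteq\mathbb{Z}/pq\mathbb{Z}$ and $S+1=\{s+1:s\in S\}$. *)

(* Defs.v *)
From mathcomp Require Import all_boot.
Set Implicit Arguments. Unset Strict Implicit. Unset Printing Implicit Defensive.

(* S_n(a) with exponents 0 <= j < m : the set { a^j mod n : 0 <= j < m } in Z/nZ.
   In the paper n = pq and m = p - 1. *)
Definition Sset (n a m : nat) : {set 'I_n} :=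
  [set x : 'I_n | [exists j : 'I_m, nat_of_ord x == a ^ j %% n]].

Definition shift1 (n : nat) (S : {set 'I_n}) : {set 'I_n} :=
  [set x : 'I_n | [exists y in S, nat_of_ord x == (nat_of_ord y + 1) %% n]].

Definition generates_units_mod (p a : nat) : Prop :=
  coprime a p /\ forall b, coprime b p -> exists j, a ^ j = b %[mod p].

(* Main.v *)
Require Import Defs.
From mathcomp Require Import all_boot.
From mathcomp Require Import all_algebra all_solvable all_field.
From mathcomp Require Import ring zify.

(** Take a prime p = 5 mod 8 with p = 1 mod 5 and a = 2 or 3 mod 5 generating
    (Z/p)^*.  Then S is the graph of the quartic character chi : F_p^* -> F_5^*
    sending the generator a mod p to a mod 5.  Extending chi by 0 to F_p, and
    since chi(-1) = -1, the number |S :&: (S + 1)| + 2 counts the x in F_p with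
    chi(x) + chi(1 - x) = 1.  Writing the indicator of t = 0 as 1 - t^4 expresses
    this count modulo 5 through Jacobi sums with values in characteristic 5; it
    equals - 2 - J with J = J(chi, chi).

    Over an extension of F_5 containing a p-th root of unity, the Frobenius gives
    g(chi)^5 = chi(5)^-1 g(chi) for the Gauss sum g(chi).  If -5 is a fourth power
    mod p, then chi(5) = -1, so J^2 = g(chi)^4 = -1 and J = 2 or -2; replacing chi
    by chi^3 exchanges the two values, so one of the choices a = 2, 3 mod 5 works.

    Infinitely many such p come from a Euclid argument.  For y = -1 - i n^2 with
    i^2 = -1, a zero of 1 + y + ... + y^4 gives (n y^3 (1 - y))^4 = -5, because
    the square root y (1 + y) (1 - y)^2 of 5 equals - i n^2 y (1 - y)^2.  The norm
    M(n) of that sum from Z[i] is 1 mod n, its prime divisors prime to 2, 5, 11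
    and n are 1 mod 4 and 1 mod 5 and have -5 as a fourth power, and for odd n one
    has M(n) = 5 mod 8, so some prime divisor is 5 mod 8. *)

Set Implicit Arguments. Unset Strict Implicit. Unset Printing Implicit Defensive.
Import GRing.Theory.
Local Open Scope ring_scope.

(** * Gauss and Jacobi sums of a finite field *)

Section JacobiSums.

Variables (F : finFieldType) (K : fieldType).
Implicit Types (chi alpha beta : F -> K) (x y s : F).

Definition mult_char chi :=
  [/\ chi 0 = 0, chi 1 = 1 & {morph chi : x y / x * y}].

Definition trivial_on_units chi := forall x, x != 0 -> chi x = 1.

Definition jacobi alpha beta := \sum_x alpha x * beta (1 - x).

Lemma mult_char_neq0 chi x : mult_char chi -> x != 0 -> chi x != 0.
Proof.
case=> _ chi1 chiM x0; apply/eqP => chix0.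
by have /eqP := chi1; rewrite -(divff x0) chiM chix0 mul0r eq_sym oner_eq0.
Qed.

Lemma mult_charV chi x : mult_char chi -> chi x^-1 = (chi x)^-1.
Proof.
move=> chiP; have [chi0 chi1 chiM] := chiP.
have [->|x0] := eqVneq x 0; first by rewrite invr0 chi0 invr0.
apply: (mulfI (mult_char_neq0 chiP x0)).
by rewrite -chiM !divff ?mult_char_neq0.
Qed.

Lemma mult_char_mul alpha beta :
  mult_char alpha -> mult_char beta -> mult_char (fun x => alpha x * beta x).
Proof.
move=> [a0 a1 aM] [b0 b1 bM]; split; first by rewrite a0 mul0r.
  by rewrite a1 b1 mulr1.
by move=> x y; rewrite aM bM; ring.
Qed.

Lemma mult_char_exp chi n :
  (0 < n)%N -> mult_char chi -> mult_char (fun x => chi x ^+ n).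
Proof.
move=> n0 [c0 c1 cM]; split; first by rewrite c0 expr0n; case: n n0.
  by rewrite c1 expr1n.
by move=> x y; rewrite cM exprMn.
Qed.

Lemma sum_mult_char chi c :
  mult_char chi -> c != 0 -> chi c != 1 -> \sum_x chi x = 0.
Proof.
move=> [c0 c1 cM] cn0 cn1; apply/eqP.
suff: (chi c - 1) * \sum_x chi x == 0 by rewrite mulf_eq0 subr_eq0 (negPf cn1).
rewrite mulrBl mul1r mulr_sumr subr_eq0; apply/eqP.
rewrite [RHS](reindex_inj (mulfI cn0)) /=.
by apply: eq_bigr => x _; rewrite cM.
Qed.

Lemma sum_trivial_char chi : chi 0 = 0 -> trivial_on_units chi ->
  \sum_x chi x = #|F|%:R - 1.
Proof.
move=> c0 triv; rewrite (bigD1 0) //= c0 add0r.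
rewrite (eq_bigr (fun=> 1)); last by move=> x; exact: triv.
rewrite sumr_const -[X in X%:R - 1](cardC (pred1 (0 : F))) card1 natrD.
by rewrite addrAC subrr add0r.
Qed.

(** On units [beta] is the inverse of [alpha], so the summand at x is alpha(x / (1 - x)). The map x
    -> x / (1 - x) is a bijection from F minus 1 onto F minus -1, and the full sum of [alpha]
    vanishes, which leaves minus the missing term. *)
Lemma jacobi_trivial alpha beta c : mult_char alpha -> mult_char beta ->
    c != 0 -> alpha c != 1 -> trivial_on_units (fun x => alpha x * beta x) ->
  jacobi alpha beta = - alpha (-1).
Proof.
move=> aP bP c0 ac1 triv; have [a0 a1 aM] := aP; have [b0 b1 bM] := bP.
rewrite /jacobi (bigD1 1) //= subrr b0 mulr0 add0r.
have -> : \sum_(x | x != 1) alpha x * beta (1 - x)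
          = \sum_(x | x != 1) alpha (x / (1 - x)).
  apply: eq_bigr => x x1; rewrite aM mult_charV //.
  have x1' : 1 - x != 0 by rewrite subr_eq0 eq_sym.
  congr (_ * _); apply: (mulfI (mult_char_neq0 aP x1')).
  by rewrite triv // divff ?mult_char_neq0.
have := sum_mult_char aP c0 ac1.
rewrite (bigD1 (-1)) //= addrC => /eqP; rewrite addr_eq0 => /eqP <-.
symmetry; rewrite (reindex_onto (fun x => x / (1 - x)) (fun y => y / (1 + y))) /=.
  apply: eq_bigl => x.
  have [->|x1] := eqVneq x 1.
    rewrite subrr invr0 mulr0 mul0r.
    by rewrite [0 == 1]eq_sym oner_eq0 andbF.
  have x1' : 1 - x != 0 by rewrite subr_eq0 eq_sym.
  have D : 1 + x / (1 - x) = (1 - x)^-1 by field.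
  rewrite D invrK divfK // eqxx andbT.
  by rewrite -addr_eq0 addrC D invr_eq0.
move=> y y1; have y1' : 1 + y != 0 by rewrite addrC addr_eq0.
have D : 1 - y / (1 + y) = (1 + y)^-1 by field.
by rewrite D invrK divfK.
Qed.

Definition gauss (psi chi : F -> K) := \sum_x chi x * psi x.

Section GaussSums.

Variable psi : F -> K.
Hypothesis psiD : {morph psi : x y / x + y >-> x * y}.
Hypothesis psi_nontriv : exists c, psi c != 1.
Hypothesis psi0 : psi 0 = 1.

Lemma sum_add_char : \sum_x psi x = 0.
Proof.
have [c c1] := psi_nontriv; apply/eqP.
suff: (psi c - 1) * \sum_x psi x == 0 by rewrite mulf_eq0 subr_eq0 (negPf c1).
rewrite mulrBl mul1r mulr_sumr subr_eq0; apply/eqP.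
rewrite [RHS](reindex_inj (addrI c)) /=.
by apply: eq_bigr => x _; rewrite psiD.
Qed.

(** The pairs (x, y) are grouped by s = x + y. For s = 0 the term beta(-x) splits off beta(-1); for
    s nonzero the substitution x -> s x extracts alpha(s) beta(s) and leaves a Jacobi sum free of
    s. *)
Lemma gauss_mul alpha beta : mult_char alpha -> mult_char beta ->
  gauss psi alpha * gauss psi beta =
    beta (-1) * (\sum_x alpha x * beta x)
    + jacobi alpha beta * \sum_(s | s != 0) alpha s * beta s * psi s.
Proof.
move=> aP bP; have [a0 a1 aM] := aP; have [b0 b1 bM] := bP.
have -> : gauss psi alpha * gauss psi beta
   = \sum_s psi s * \sum_x alpha x * beta (s - x).
  rewrite /gauss mulr_suml.
  under [RHS]eq_bigr do rewrite mulr_sumr.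
  rewrite [RHS]exchange_big /=; apply: eq_bigr => x _.
  rewrite mulr_sumr [RHS](reindex_inj (addrI x)) /=.
  by apply: eq_bigr => y _; rewrite psiD [x + y - x]addrC addKr; ring.
rewrite (bigD1 0) //=; congr (_ + _).
  rewrite psi0 mul1r mulr_sumr; apply: eq_bigr => x _.
  by rewrite sub0r -[in LHS](mulN1r x) bM; ring.
rewrite mulr_sumr; apply: eq_bigr => s s0.
rewrite (reindex_inj (mulfI s0)) /= /jacobi mulr_suml mulr_sumr.
apply: eq_bigr => x _.
by rewrite (_ : s - s * x = s * (1 - x)) ?aM ?bM; ring.
Qed.

Lemma gauss_mul_nontriv alpha beta c : mult_char alpha -> mult_char beta ->
    c != 0 -> alpha c * beta c != 1 ->
  gauss psi alpha * gauss psi beta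
    = jacobi alpha beta * gauss psi (fun x => alpha x * beta x).
Proof.
move=> aP bP c0 c1; rewrite gauss_mul // (sum_mult_char (mult_char_mul aP bP) c0) //.
rewrite mulr0 add0r /gauss; congr (_ * _).
by have [a0 _ _] := aP; rewrite [RHS](bigD1 0) //= a0 !mul0r add0r.
Qed.

Lemma gauss_mul_triv alpha beta c : mult_char alpha -> mult_char beta ->
    c != 0 -> alpha c != 1 -> trivial_on_units (fun x => alpha x * beta x) ->
  gauss psi alpha * gauss psi beta = alpha (-1) * #|F|%:R.
Proof.
move=> aP bP c0 c1 triv; rewrite gauss_mul // (jacobi_trivial aP bP c0 c1 triv).
have [a0 a1 aM] := aP.
rewrite sum_trivial_char ?a0 ?mul0r //.
have -> : \sum_(s | s != 0) alpha s * beta s * psi s = -1.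
  rewrite (eq_bigr psi) => [|s s0]; last by rewrite triv ?mul1r.
  by have := sum_add_char; rewrite (bigD1 0) //= psi0 => /eqP;
    rewrite addrC addr_eq0 => /eqP.
have -> : beta (-1) = alpha (-1).
  have N0 : -1 != 0 :> F by rewrite oppr_eq0 oner_eq0.
  apply: (mulfI (mult_char_neq0 aP N0)); rewrite triv //.
  by rewrite -aM mulrNN mulr1 a1.
ring.
Qed.

End GaussSums.
End JacobiSums.

(** * Quartic characters with values in characteristic 5 *)

Section QuarticCharacter.

Variables (F : finFieldType) (K : fieldType) (psi : F -> K).
Hypothesis pchar5 : 5 \in [pchar K].
Hypothesis psiD : {morph psi : x y / x + y >-> x * y}.
Hypothesis psi_nontriv : exists c, psi c != 1.
Hypothesis psi0 : psi 0 = 1.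
Hypothesis cardF1 : #|F|%:R = 1 :> K.

(** The element c forces the order to be exactly 4 and witnesses the nontriviality of chi, chi^2 and
    chi^3 together. *)
Definition quartic_char (chi : F -> K) :=
  [/\ mult_char chi, forall x, x != 0 -> chi x ^+ 4 = 1, chi (-1) = -1
    & exists2 c, c != 0 & chi c ^+ 2 = -1].

Lemma natr5 : 5%:R = 0 :> K. Proof. exact: pcharf0. Qed.

Lemma neq1N1 : -1 != 1 :> K.
Proof.
apply/eqP => e; have : 2%:R == 0 :> K by rewrite -{1}e mulr2n -{2}e subrr.
by rewrite -(dvdn_pcharf pchar5).
Qed.

Lemma quartic_charX5 chi x : quartic_char chi -> chi x ^+ 5 = chi x.
Proof.
case=> -[c0 _ _] c4 _ _; have [->|x0] := eqVneq x 0; first by rewrite c0 expr0n.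
by rewrite exprS c4 // mulr1.
Qed.

Lemma quartic_char_cube chi : quartic_char chi ->
  quartic_char (fun x => chi x ^+ 3).
Proof.
move=> chiP; have [cP c4 cN [c cn0 cc]] := chiP; split.
- exact: mult_char_exp.
- by move=> x x0; rewrite exprAC c4 // expr1n.
- by rewrite cN; ring.
by exists c; rewrite // exprAC cc; ring.
Qed.

Lemma sum_quartic_char chi n : quartic_char chi -> (0 < n < 4)%N ->
  \sum_x chi x ^+ n = 0.
Proof.
move=> [cP c4 cN [c cn0 cc]] n4.
apply: (@sum_mult_char _ _ (fun x => chi x ^+ n) c) => //.
  by apply: mult_char_exp => //; case/andP: n4.
have N1 := neq1N1; case: n n4 => [|[|[|[|]]]] //= _.
- by apply/eqP => e; move: N1; rewrite -cc (e : chi c = 1) expr1n eqxx.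
- by rewrite cc.
apply/eqP => e; move: N1; have : chi c ^+ 3 ^+ 2 = 1 by rewrite e expr1n.
by rewrite exprAC cc (_ : (-1) ^+ 3 = -1) => [->|]; [rewrite eqxx | ring].
Qed.

Notation g chi := (gauss psi chi).

Lemma eq_gauss (alpha beta : F -> K) : alpha =1 beta -> g alpha = g beta.
Proof. by move=> e; apply: eq_bigr => x _; rewrite e. Qed.

Section Fixed.

Variable chi : F -> K.
Hypothesis chiP : quartic_char chi.

Let chi2 x := chi x ^+ 2.
Let chi3 x := chi x ^+ 3.

Let cP : mult_char chi. Proof. by case: chiP. Qed.
Let c2P : mult_char chi2. Proof. exact: mult_char_exp. Qed.
Let c3P : mult_char chi3. Proof. exact: mult_char_exp. Qed.
Let N0 : -1 != 0 :> F. Proof. by rewrite oppr_eq0 oner_eq0. Qed.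
Let cN : chi (-1) = -1. Proof. by case: chiP. Qed.

Lemma gauss13 : g chi * g chi3 = -1.
Proof.
have [_ c4 _ _] := chiP.
rewrite (gauss_mul_triv psiD psi_nontriv psi0 cP c3P N0) ?cN ?neq1N1 ?cardF1 ?mulr1 //.
Qed.

Lemma gauss22 : g chi2 * g chi2 = 1.
Proof.
have [_ c4 _ [c cn0 cc]] := chiP.
have c21 : chi2 c != 1 by rewrite /chi2 cc neq1N1.
rewrite (gauss_mul_triv psiD psi_nontriv psi0 c2P c2P cn0) //.
  by rewrite cardF1 mulr1 /chi2 cN; ring.
by move=> x x0; rewrite /= /chi2 -exprD c4.
Qed.

Lemma gauss11 : g chi * g chi = jacobi chi chi * g chi2.
Proof.
have [_ c4 _ [c cn0 cc]] := chiP.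
rewrite (gauss_mul_nontriv psiD psi0 cP cP cn0) -?expr2 ?cc ?neq1N1 //.
Qed.

Lemma gauss33 : g chi3 * g chi3 = jacobi chi3 chi3 * g chi2.
Proof.
have [_ c4 _ [c cn0 cc]] := chiP.
rewrite (gauss_mul_nontriv psiD psi0 c3P c3P cn0).
  congr (_ * _); apply: eq_gauss => x.
  by rewrite /chi2 /chi3 -exprD (exprD _ 5 1) quartic_charX5.
by rewrite -expr2 /chi3 exprAC cc -signr_odd /= expr1 neq1N1.
Qed.

(** The product g(chi)^2 g(chi^2) is evaluated in two ways: grouping g(chi) with g(chi^2) gives
    -J(chi, chi^2), and grouping the two factors g(chi) gives J(chi, chi). *)
Lemma jacobi12 : jacobi chi chi2 = - jacobi chi chi.
Proof.
have [_ c4 _ [c cn0 cc]] := chiP.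
have E : g chi * g chi2 = jacobi chi chi2 * g chi3.
  rewrite (gauss_mul_nontriv psiD psi0 cP c2P N0) /chi2 ?cN.
    by congr (_ * _); apply: eq_gauss => x; rewrite -exprS.
  by rewrite sqrrN expr1n mulr1 neq1N1.
have : jacobi chi chi2 * (g chi * g chi3) = jacobi chi chi * (g chi2 * g chi2).
  by rewrite mulrCA -E !mulrA -gauss11.
by rewrite gauss13 gauss22 mulr1 mulrN1 => <-; rewrite opprK.
Qed.

Lemma jacobiC (alpha beta : F -> K) : jacobi alpha beta = jacobi beta alpha.
Proof.
rewrite /jacobi (reindex_inj (can_inj (subKr 1))) /=.
by apply: eq_bigr => x _; rewrite subKr mulrC.
Qed.

Lemma jacobi13 : jacobi chi chi3 = 1.
Proof.
have [_ c4 _ _] := chiP.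
rewrite (jacobi_trivial cP c3P N0) ?cN ?opprK ?neq1N1 //.
Qed.

Lemma jacobi22 : jacobi chi2 chi2 = -1.
Proof.
have [_ c4 _ [c cn0 cc]] := chiP.
rewrite (jacobi_trivial c2P c2P cn0) /chi2 ?cc ?neq1N1 ?cN //.
  by rewrite sqrrN expr1n.
by move=> x x0; rewrite /= -exprD c4.
Qed.

(** Counterpart in characteristic 5 of |J|^2 = p, where p becomes 1 by [cardF1]. *)
Lemma jacobi_conj : jacobi chi chi * jacobi chi3 chi3 = 1.
Proof.
have : (jacobi chi chi * jacobi chi3 chi3) * (g chi2 * g chi2) = (g chi * g chi3) ^+ 2.
  transitivity ((g chi * g chi) * (g chi3 * g chi3)); last by ring.
  by rewrite gauss11 gauss33; ring.
by rewrite gauss22 gauss13 mulr1 sqrrN expr1n.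
Qed.

(* Frobenius maps the Gauss sum to sum_x chi(x) psi(5x) = chi(5)^-1 g(chi). *)
Lemma gauss_exp4 : chi 5%:R = -1 -> g chi ^+ 4 = -1.
Proof.
move=> chi5; have [c0 _ cM] := cP.
have five0 : 5%:R != 0 :> F.
  apply/eqP => e; move: chi5; rewrite e c0 => /eqP.
  by rewrite eq_sym oppr_eq0 oner_eq0.
have g0 : g chi != 0.
  apply/eqP => e; have := gauss13; rewrite e mul0r => /eqP.
  by rewrite eq_sym oppr_eq0 oner_eq0.
apply: (mulfI g0); rewrite -exprS mulrN1.
rewrite -(pFrobenius_autE pchar5) rmorph_sum /gauss /=.
rewrite [in RHS](reindex_inj (mulfI five0)) /= -sumrN; apply: eq_bigr => x _.
rewrite pFrobenius_autE exprMn quartic_charX5 // cM chi5 mulN1r mulNr opprK.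
congr (_ * _); rewrite (_ : 5%:R * x = x + (x + (x + (x + x)))); last by ring.
by rewrite !psiD; ring.
Qed.

Lemma jacobi_sqr : chi 5%:R = -1 -> jacobi chi chi ^+ 2 = -1.
Proof.
move=> /gauss_exp4; rewrite (_ : g chi ^+ 4 = (g chi * g chi) ^+ 2); last by ring.
by rewrite gauss11 exprMn [g chi2 ^+ 2]expr2 gauss22 mulr1.
Qed.

(* Values of chi lie in the prime field, so 1 - t^4 with
   t = chi x + chi (1 - x) - 1 is the indicator of t = 0. *)
Lemma card_quartic_sum1 :
  #|[set x : F | chi x + chi (1 - x) == 1]|%:R = - 2%:R - jacobi chi chi.
Proof.
have [_ c4 _ _] := chiP; have [c0 _ _] := cP.
pose t x := chi x + chi (1 - x) - 1.
have ind x : (chi x + chi (1 - x) == 1)%:R = 1 - t x ^+ 4.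
  have t5 : t x ^+ 5 = t x.
    rewrite /t -!(pFrobenius_autE pchar5) rmorphB rmorphD rmorph1 /=.
    by rewrite !pFrobenius_autE !quartic_charX5.
  rewrite -subr_eq0 -/(t x); have [->|tx0] := eqVneq (t x) 0.
    by rewrite expr0n subr0.
  by apply/esym/eqP; rewrite subr_eq0 eq_sym -(inj_eq (mulfI tx0)) -exprS t5 mulr1.
have sumC n : \sum_x chi (1 - x) ^+ n = \sum_x chi x ^+ n.
  by rewrite [RHS](reindex_inj (can_inj (subKr 1))).
have sum4 : \sum_x chi x ^+ 4 = 0.
  rewrite (@sum_trivial_char _ _ (fun x => chi x ^+ 4)) ?c0 ?expr0n //.
  by rewrite cardF1 subrr.
have j13 : \sum_x chi x * chi (1 - x) ^+ 3 = 1 := jacobi13.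
have j31 : \sum_x chi x ^+ 3 * chi (1 - x) = 1.
  by rewrite -jacobi13 jacobiC.
have j22 : \sum_x chi x ^+ 2 * chi (1 - x) ^+ 2 = -1 := jacobi22.
have j12 : \sum_x chi x * chi (1 - x) ^+ 2 = - jacobi chi chi := jacobi12.
have j21 : \sum_x chi x ^+ 2 * chi (1 - x) = - jacobi chi chi.
  by rewrite -jacobi12 jacobiC.
have j11 : \sum_x chi x * chi (1 - x) = jacobi chi chi by [].
have s1 : \sum_(x : F) 1 = 1 :> K by rewrite sumr_const cardF1.
have sn n : (0 < n < 4)%N -> \sum_x chi x ^+ n = 0 by exact: sum_quartic_char.
rewrite -sum1_card natr_sum big_mkcond /=.
transitivity (\sum_x (1 - t x ^+ 4)).
  by apply: eq_bigr => x _; rewrite inE -ind; case: ifP.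
(* The expansion of 1 - t^4, grouped into monomials whose sums over x are power sums or Jacobi sums.
   The exponent 1 is kept visible so that [sn] applies to it. *)
pose E x := - (chi x ^+ 4 + chi (1 - x) ^+ 4)
  - 4%:R * (chi x ^+ 3 * chi (1 - x) + chi x * chi (1 - x) ^+ 3)
  - 6%:R * (chi x ^+ 2 * chi (1 - x) ^+ 2)
  + 12%:R * (chi x ^+ 2 * chi (1 - x) + chi x * chi (1 - x) ^+ 2)
  - 12%:R * (chi x * chi (1 - x))
  + 4%:R * (chi x ^+ 3 + chi (1 - x) ^+ 3)
  - 6%:R * (chi x ^+ 2 + chi (1 - x) ^+ 2)
  + 4%:R * (chi x ^+ 1 + chi (1 - x) ^+ 1).
transitivity (\sum_x E x); first by apply: eq_bigr => x _; rewrite /E /t; ring.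
rewrite /E !(big_split, sumrN, =^~ mulr_sumr) /=.
rewrite !sumC sum4 !sn // j13 j31 j22 j12 j21 j11.
(* The sum has become -2 - 36 J, and 36 = 1 + 7 * 5. *)
transitivity (- 2%:R - jacobi chi chi - 7%:R * 5%:R * jacobi chi chi : K); first ring.
by rewrite natr5 mulr0 mul0r subr0.
Qed.

End Fixed.

Lemma exists_card_quartic_sum1 chi : quartic_char chi -> chi 5%:R = -1 ->
  exists2 k, k \in [:: 1; 3]%N &
    #|[set x : F | chi x ^+ k + chi (1 - x) ^+ k == 1]|%:R = 0 :> K.
Proof.
move=> chiP chi5; have J2 := jacobi_sqr chiP chi5; have JJ := jacobi_conj chiP.
set J := jacobi chi chi in J2 JJ.
have : (J + 2%:R) * (J - 2%:R) = 0.
  transitivity (J ^+ 2 + 1 - 5%:R); first ring.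
  by rewrite J2 natr5 addNr subr0.
move/eqP; rewrite mulf_eq0 => /orP[/eqP J0|/eqP J0].
  exists 1%N => //.
  by rewrite (card_quartic_sum1 chiP) -/J -opprD addrC J0 oppr0.
exists 3%N => //; rewrite (card_quartic_sum1 (quartic_char_cube chiP)).
set J' := jacobi _ _ in JJ *; rewrite -opprD; apply/eqP; rewrite oppr_eq0; apply/eqP.
have eJ : J = 2%:R by apply/eqP; rewrite -subr_eq0 J0.
rewrite eJ in JJ.
(* With J = 2, [jacobi_conj] reads 2 J' = 1, whose solution in characteristic 5 is J' = -2. *)
transitivity (5%:R * J' - 2%:R * (2%:R * J' - 1)); first ring.
by rewrite JJ natr5 mul0r subrr mulr0 subr0.
Qed.

End QuarticCharacter.

(** * Additive characters of F_p and multiplicative characters from discrete logarithms *)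

Lemma finField_prim_root (F : finFieldType) :
  exists z : F, #|F|.-1.-primitive_root z.
Proof.
have n0 : (0 < #|F|.-1)%N by rewrite -subn1 subn_gt0 finNzRing_gt1.
pose rs := enum [pred x : F | x != 0].
have /hasP[z _ zP] : has #|F|.-1.-primitive_root rs; last by exists z.
apply: has_prim_root => //; last first.
- by rewrite -cardE -(cardC1 (0 : F)); apply: subset_leq_card; apply/subsetP.
- exact: enum_uniq.
apply/allP => x; rewrite mem_enum inE unity_rootE => x0.
apply/eqP/(mulfI x0); rewrite -exprS prednK ?mulr1 ?expf_card //.
exact: ltnW (finNzRing_gt1 F).
Qed.

(** By Fermat p divides 5^(p-1) - 1, so the field with 5^(p-1) elements contains a primitive p-th
    root of unity w, and psi(x) = w^x. *)
Lemma exists_add_char p : prime p -> p != 5 ->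
  exists K : fieldType, 5 \in [pchar K] /\
  exists psi : 'F_p -> K, [/\ {morph psi : x y / x + y >-> x * y},
    exists c, psi c != 1 & psi 0 = 1].
Proof.
move=> p_pr p5; have p1 := prime_gt1 p_pr.
have [|K pK cK] := @pPrimePowerField 5 p.-1 isT; first by case: p p1 {p_pr p5} => [|[]].
exists K; split=> //; have [z zP] := finField_prim_root K.
have dvd_p : (p %| #|K|.-1)%N.
  have co : coprime 5 p by rewrite prime_coprime // dvdn_prime2 // eq_sym.
  have := Euler_exp_totient co; rewrite totient_prime // -cK -subn1 => /eqP.
  by rewrite eqn_mod_dvd // cK expn_gt0.
have wP := dvdn_prim_root zP dvd_p; set w := z ^+ _ in wP.
exists (fun x : 'F_p => w ^+ (x : nat)); split; last by rewrite expr0.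
- move=> x y; rewrite -exprD; apply/eqP; rewrite (eq_prim_root_expr wP).
  have FpE m : (m %% (Zp_trunc (pdiv p)).+2 = m %% p)%N by rewrite Fp_cast.
  by rewrite /= FpE modn_mod.
exists 1; rewrite -(prim_order_dvd wP) /= Fp_cast // modn_small //.
by rewrite dvdn1 gtn_eqF.
Qed.

Section PowerCharacter.

Variables (F K : fieldType) (n : nat) (gam : F) (bet : K).
Hypothesis gamP : n.-primitive_root gam.
Hypothesis betn : bet ^+ n = 1.

(** When [gam] generates the units, this is the multiplicative character sending [gam] to [bet]; the
    default value 0 is its extension by zero. *)
Definition power_char (x : F) : K :=
  oapp (fun i : 'I_n => bet ^+ i) 0 [pick i : 'I_n | x == gam ^+ i].

Lemma power_char0 : power_char 0 = 0.
Proof.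
rewrite /power_char; case: pickP => //= i /eqP e.
have : gam ^+ n != 0 by rewrite prim_expr_order // oner_eq0.
have i0 : gam ^+ i != 0.
  rewrite expf_neq0 //; apply/eqP => g0; move: (prim_expr_order gamP).
  by rewrite g0 expr0n (gtn_eqF (prim_order_gt0 gamP)) => /eqP; rewrite eq_sym oner_eq0.
by rewrite -e eqxx in i0.
Qed.

Lemma power_charX k : power_char (gam ^+ k) = bet ^+ k.
Proof.
rewrite /power_char; case: pickP => [i|no] /=.
  rewrite (eq_prim_root_expr gamP) => /eqP e.
  by rewrite -(expr_mod k betn) e expr_mod.
have lt : (k %% n < n)%N by rewrite ltn_mod (prim_order_gt0 gamP).
by have := no (Ordinal lt); rewrite /= (eq_prim_root_expr gamP) modn_mod eqxx.
Qed.

End PowerCharacter.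

Section PrimeField.

Variables (p : nat) (K : fieldType).
Hypothesis p_pr : prime p.

Let p1 := prime_gt1 p_pr.

Lemma Fp_natr_eq (m m' : nat) : (m%:R == m'%:R :> 'F_p) = (m == m' %[mod p]).
Proof.
apply/eqP/eqP => e.
  by have /(congr1 val) := e; rewrite /= !val_Fp_nat.
by rewrite -(Fp_nat_mod p_pr m) e Fp_nat_mod.
Qed.

Lemma Fp_prim_root : exists g : nat, p.-1.-primitive_root (g%:R : 'F_p).
Proof.
have [z] := finField_prim_root 'F_p; rewrite card_Fp // => zP.
by exists (z : nat); rewrite natr_Zp.
Qed.

Lemma Fp_unitX (x : 'F_p) : x != 0 -> x ^+ p.-1 = 1.
Proof.
move=> x0; apply: (mulfI x0).
by rewrite -exprS prednK ?(ltnW p1) // mulr1 -[RHS](expf_card x) card_Fp.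
Qed.

Variables (gam : 'F_p) (bet : K).
Hypothesis gamP : p.-1.-primitive_root gam.
Hypothesis betn : bet ^+ p.-1 = 1.

Notation chi := (power_char p.-1 gam bet).

Lemma Fp_dlog (x : 'F_p) : x != 0 -> exists2 j, (j < p.-1)%N & x = gam ^+ j.
Proof.
by move=> /Fp_unitX /(prim_rootP gamP)[i ->]; exists i.
Qed.

Lemma power_char_mult : mult_char chi.
Proof.
have c0 := power_char0 bet gamP; have cX := power_charX gamP betn.
split=> //; first by rewrite -(expr0 gam) cX.
move=> x y; have [->|x0] := eqVneq x 0; first by rewrite mul0r c0 mul0r.
have [->|y0] := eqVneq y 0; first by rewrite mulr0 c0 mulr0.
have [i _ ->] := Fp_dlog x0; have [j _ ->] := Fp_dlog y0.
by rewrite -exprD !cX exprD.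
Qed.

Lemma Fp_prim_rootN1 : odd p -> gam ^+ p.-1./2 = -1.
Proof.
move=> odd_p; have p_gt2 : (2 < p)%N by case: (p) odd_p p1 => [|[|[]]].
have e : p.-1 = p.-1./2.*2 by lia.
have : (gam ^+ p.-1./2) ^+ 2 == 1.
  by rewrite -exprM muln2 -e (prim_expr_order gamP).
rewrite sqrf_eq1 -(prim_order_dvd gamP) => /orP[/dvdn_leq|/eqP //].
by lia.
Qed.

End PrimeField.

(** * Infinitely many primes p = 5 mod 8 having -5 as a fourth power *)

Lemma modn8_eq1 M : (0 < M)%N -> (forall p, prime p -> p %| M -> p %% 8 = 1)%N ->
  (M %% 8 = 1)%N.
Proof.
elim/ltn_ind: M => M IH M0 HM.
have [M1|M1] := leqP M 1; first by have -> : M = 1%N by lia.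
have := pdiv_prime M1; have := pdiv_dvd M.
move: (pdiv M) => p pM p_pr; have p8 := HM p p_pr pM; have /dvdnP[k kM] := pM.
have k0 : (0 < k)%N by move: M0; rewrite kM muln_gt0 => /andP[].
rewrite kM -(modnMm k p) p8 muln1 modn_mod; apply: IH => //.
- by rewrite kM ltn_Pmulr ?prime_gt1.
by move=> q q_pr qk; apply: HM => //; rewrite kM dvdn_mulr.
Qed.

(** A prime that is 1 mod 4 is 1 or 5 mod 8, and a product of primes that are all 1 mod 8 is again 1
    mod 8. *)
Lemma prime_factor_5mod8 M : (M %% 8 = 5)%N ->
  (forall p, prime p -> p %| M -> p %% 4 = 1)%N ->
  exists p, [/\ prime p, (p %| M)%N & (p %% 8 = 5)%N].
Proof.
move=> M5 HM; have M0 : (0 < M)%N by case: M M5 {HM}.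
have [/hasP[p]|/hasPn no] := boolP (has (fun p => p %% 8 == 5)%N (primes M)).
  by rewrite mem_primes => /and3P[p_pr _ pM] /eqP p5; exists p.
suff : (M %% 8 = 1)%N by rewrite M5.
apply: modn8_eq1 => // p p_pr pM; have p4 := HM p p_pr pM.
by have := no p; rewrite mem_primes p_pr M0 pM => /(_ isT); lia.
Qed.

(** Write x = g^j with g a generator: p - 1 divides j q. If q did not divide p - 1, it would be
    coprime to it, so p - 1 would divide j and x would be 1. *)
Lemma Fp_root1_dvd p q (x : 'F_p) : prime p -> prime q ->
  x ^+ q = 1 -> x != 1 -> (q %| p.-1)%N.
Proof.
move=> p_pr q_pr xq x1.
have [g gP] := Fp_prim_root p_pr.
have x0 : x != 0.
  by apply/eqP => e; move: xq; rewrite e expr0n gtn_eqF ?prime_gt0 // => /eqP;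
    rewrite eq_sym oner_eq0.
have [j _ xE] := Fp_dlog p_pr gP x0; apply: contraR x1 => ndvd.
move: xq; rewrite xE -exprM => /eqP; rewrite -(prim_order_dvd gP) => d.
rewrite -(prim_order_dvd gP) -(@Gauss_dvdl _ _ q) //.
by rewrite coprime_sym prime_coprime.
Qed.

Lemma Fp_sqrtN1_mod4 p (x : 'F_p) : prime p -> odd p -> x ^+ 2 = -1 -> (p %% 4 = 1)%N.
Proof.
move=> p_pr odd_p x2; have p1 := prime_gt1 p_pr.
have x0 : x != 0.
  by apply/eqP => e; move/eqP: x2; rewrite e expr0n eq_sym oppr_eq0 oner_eq0.
have e : p.-1 = (2 * p.-1./2)%N by lia.
have := Fp_unitX p_pr x0; rewrite e exprM x2 -signr_odd.
case: (boolP (odd _)) => [_ /=|]; last by lia.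
rewrite expr1 => /eqP; rewrite -subr_eq0 -opprD oppr_eq0 -(natrD _ 1 1).
rewrite -(dvdn_pcharf (pchar_Fp p_pr)) dvdn_prime2 // => /eqP p2.
by rewrite p2 in odd_p.
Qed.

(* With i^2 = -1 and y = -1 - i m, the value 1 + y + ... + y^4 is
   (m^4 - 4 m^2 + 1) + i (2 m - 3 m^3); this is its norm from Z[i] to Z. *)
Definition phi5_norm (m : nat) : nat := m ^ 8 + m ^ 6 + 6 * m ^ 4 + 1 - 4 * m ^ 2.

Lemma phi5_normE (R : comRingType) (m : nat) : (0 < m)%N ->
  (phi5_norm m)%:R = (m%:R ^+ 4 - 4%:R * m%:R ^+ 2 + 1) ^+ 2
                     + (2%:R * m%:R - 3%:R * m%:R ^+ 3) ^+ 2 :> R.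
Proof.
move=> m0; rewrite /phi5_norm natrB; last first.
  (* This makes the truncated subtraction in [phi5_norm] exact. *)
  have : (m ^ 2 <= m ^ 4)%N by rewrite leq_pexp2l.
  by lia.
rewrite !natrD !(natrX, natrM); ring.
Qed.

Lemma phi5_norm_mod8 m : (m %% 8 = 1)%N -> (phi5_norm m %% 8 = 5)%N.
Proof.
move=> m8; have m0 : (0 < m)%N by case: m m8.
have m24 : (m ^ 2 <= m ^ 4)%N by rewrite leq_pexp2l.
have m4 : (0 < m ^ 4)%N by rewrite expn_gt0 m0.
have mX k : (m ^ k %% 8 = 1)%N by rewrite -modnXm m8 exp1n.
have := mX 8%N; have := mX 6%N; have := mX 4%N; have := mX 2%N.
move: m24 m4; rewrite /phi5_norm.
by move: (m ^ 2)%N (m ^ 4)%N (m ^ 6)%N (m ^ 8)%N => a b c d; lia.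
Qed.

Lemma phi5_norm_prime_divisor p n : prime p -> p \notin [:: 2; 5; 11]%N ->
    ~~ (p %| n)%N -> (p %| phi5_norm (n ^ 2))%N ->
  [/\ (p %% 4 = 1)%N, (p %% 5 = 1)%N & exists r : 'F_p, r ^+ 4 = - 5%:R].
Proof.
move=> p_pr; rewrite !inE !negb_or => /and3P[p2 p5 p11] pn.
have pcharF := pchar_Fp p_pr.
have natF0 q : prime q -> p != q -> q%:R != 0 :> 'F_p.
  by move=> q_pr; rewrite -(dvdn_pcharf pcharF) dvdn_prime2.
have n0 : (0 < n ^ 2)%N.
  by rewrite expn_gt0 orbF lt0n; apply: contraNneq pn => ->; rewrite dvdn0.
rewrite (dvdn_pcharf pcharF) phi5_normE // natrX.
have : n%:R != 0 :> 'F_p by rewrite -(dvdn_pcharf pcharF).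
move: (n%:R : 'F_p) => {pn n0}n n0.
set m := n ^+ 2; set A := _ ^+ 4 - _ + 1; set B := _ - _ => /eqP AB0.
have m0 : m != 0 by rewrite expf_neq0.
(* If B = 0 then also A = 0. The polynomials 2 - 3 m^2 and A have 11 as an integral combination, so
   p would be 11. *)
have B0 : B != 0.
  apply/eqP => B0; have A0 : A = 0.
    by apply/eqP; move: AB0; rewrite B0 expr0n addr0 => /eqP; rewrite sqrf_eq0.
  have m2 : 2%:R - 3%:R * m ^+ 2 = 0.
    by apply: (mulfI m0); rewrite mulr0 -B0 /B; ring.
  have /eqP := natF0 11 isT p11; apply.
  transitivity ((2%:R - 3%:R * m ^+ 2) * (10%:R - 3%:R * m ^+ 2) - 9%:R * A).
    by rewrite /A; ring.
  by rewrite m2 A0 mul0r mulr0 subr0.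
(* Since A^2 + B^2 = 0 with B nonzero, this ratio is a square root of -1 and satisfies A + I B =
   0. *)
pose I := - A / B.
have I2 : I ^+ 2 = -1.
  apply: (mulIf (expf_neq0 2 B0)); rewrite /I expr_div_n divfK ?expf_neq0 //.
  by apply/eqP; rewrite sqrrN mulN1r -addr_eq0 AB0.
have AIB : A + I * B = 0 by rewrite /I divfK // subrr.
pose y := - 1 - I * m.
(* The polynomial equals A + I B modulo I^2 + 1; the extra multiple of I^2 + 1 makes the identity
   exact for [ring]. *)
have phi_y : 1 + y + y ^+ 2 + y ^+ 3 + y ^+ 4 = 0.
  transitivity (A + I * B + (I ^+ 2 + 1) *
     (m ^+ 4 * (I ^+ 2 - 1) + I * m ^+ 3 * 3%:R + 4%:R * m ^+ 2)).
    by rewrite /A /B /y; ring.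
  by rewrite AIB I2 addNr mul0r addr0.
have y5 : y ^+ 5 = 1.
  apply/eqP; rewrite -subr_eq0; apply/eqP.
  transitivity ((y - 1) * (1 + y + y ^+ 2 + y ^+ 3 + y ^+ 4)); first ring.
  by rewrite phi_y mulr0.
have y1 : y != 1.
  apply/eqP => e; have /eqP := natF0 5 isT p5; apply.
  by rewrite -phi_y e; ring.
have odd_p : odd p by case/even_prime: p_pr p2 => [->|].
split; first exact: Fp_sqrtN1_mod4 I2.
  have := Fp_root1_dvd p_pr (isT : prime 5) y5 y1.
  by have := prime_gt1 p_pr; lia.
(* Its fourth power is m^2 y^12 (1 - y)^4. With m^2 = -(1 + y)^2 and y^5 = 1 this is minus the
   square of y (1 + y) (1 - y)^2 = y - y^2 - y^3 + y^4, the quadratic Gauss sum mod 5, whose square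
   is 5. *)
exists (n * y ^+ 3 * (1 - y)).
have m2E : m ^+ 2 = - (1 + y) ^+ 2.
  transitivity (- (I ^+ 2 * m ^+ 2)); first by rewrite I2; ring.
  by rewrite /y; ring.
transitivity (m ^+ 2 * (y ^+ 5) ^+ 2 * y ^+ 2 * (1 - y) ^+ 4).
  by rewrite /m; ring.
rewrite m2E y5.
transitivity (- 5%:R + (1 + y + y ^+ 2 + y ^+ 3 + y ^+ 4)
              - (y ^+ 5 - 1) * (4%:R - y - 2%:R * y ^+ 2 + y ^+ 3)); first ring.
by rewrite phi_y y5 subrr mul0r subr0 addr0.
Qed.

Lemma infinitely_many_primes_quartic_N5 N : exists p,
  [/\ (N < p)%N, prime p, (p %% 8 = 5)%N, (p %% 5 = 1)%N
    & exists r : 'F_p, r ^+ 4 = - 5%:R].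
Proof.
(* The product of the odd numbers below 2 N + 24. The shift 12 makes 5 and 11 divide n for every N.
   Prime divisors of the norm do not divide n, so they avoid 5, 11 and all odd primes up to N. *)
pose n := (\prod_(i < N + 12) i.*2.+1)%N.
have odd_n : odd n.
  rewrite /n; elim/big_ind: _ => // [x y xo yo|i _]; first by rewrite oddM xo yo.
  by rewrite /= odd_double.
have M5 : (phi5_norm (n ^ 2) %% 8 = 5)%N.
  apply: phi5_norm_mod8; move: odd_n; rewrite -{2}[n]odd_double_half => ->.
  move: n./2 => k; rewrite -mul2n; have : odd k \/ ~~ odd k by case: odd; [left|right].
  by nia.
have key p : prime p -> (p %| phi5_norm (n ^ 2))%N ->
    p \notin [:: 2; 5; 11]%N /\ ~~ (p %| n)%N.
  move=> p_pr pM.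
  have pn : ~~ (p %| n)%N.
    apply/negP => pn; move: pM; rewrite (dvdn_pcharf (pchar_Fp p_pr)) phi5_normE.
      have /eqP n0 : n%:R == 0 :> 'F_p by rewrite -(dvdn_pcharf (pchar_Fp p_pr)).
      rewrite natrX n0 expr0n /= => /eqP e.
      have /eqP[] := oner_neq0 'F_p; rewrite -[RHS]e; ring.
    by rewrite expn_gt0; case: (n) odd_n.
  split=> //; have dn q : odd q -> (q < N + 12)%N -> (q %| n)%N.
    move=> q_odd qN; have hq : (q./2 < N + 12)%N by lia.
    rewrite /n (bigD1 (Ordinal hq)) //= (_ : (q./2).*2.+1 = q); last by lia.
    exact: dvdn_mulr.
  rewrite !inE; apply/negP => /or3P[] /eqP e.
  - by move: pM M5; rewrite e; move: (phi5_norm _) => M; lia.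
  - by move: pn; rewrite e dn //; lia.
  by move: pn; rewrite e dn //; lia.
have [|p [p_pr pM p8]] := prime_factor_5mod8 M5.
  move=> p p_pr pM; have [p_small pn] := key p p_pr pM.
  by have [] := phi5_norm_prime_divisor p_pr p_small pn pM.
have [p_small pn] := key p p_pr pM.
have [_ p5 pr] := phi5_norm_prime_divisor p_pr p_small pn pM.
exists p; split=> //; rewrite ltnNge; apply/negP => pN; move/negP: pn; apply.
have hp : (p./2 < N + 12)%N by lia.
rewrite /n (bigD1 (Ordinal hp)) //= (_ : (p./2).*2.+1 = p); last by lia.
exact: dvdn_mulr.
Qed.

(** * The set S as the graph of a character *)

Section OrbitCount.

Variables (p a : nat) (K : fieldType).
Hypotheses (p_pr : prime p) (p5 : p != 5) (pchar5 : 5 \in [pchar K]).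
Hypothesis aP : p.-1.-primitive_root (a%:R : 'F_p).
Hypothesis aKn : (a%:R : K) ^+ p.-1 = 1.

Notation chi := (power_char p.-1 (a%:R : 'F_p) (a%:R : K)).
Notation S := (Sset (5 * p) a (p - 1)).

Let fp0 : (0 < 5 * p)%N. Proof. by rewrite muln_gt0 /=; exact: prime_gt0. Qed.
Let chiX k : chi (a%:R ^+ k) = a%:R ^+ k. Proof. exact: power_charX. Qed.

(** Chinese remainder theorem, with congruence mod 5 tested in the prime field of [K]. *)
Lemma eqmod5p (m m' : nat) :
  (m == m' %[mod 5 * p]) = (m%:R == m'%:R :> 'F_p) && (m%:R == m'%:R :> K).
Proof.
have co : coprime 5 p by rewrite prime_coprime // dvdn_prime2 // eq_sym.
rewrite chinese_remainder // Fp_natr_eq // andbC; congr (_ && _).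
apply/eqP/eqP => e; first by rewrite -(GRing.natr_mod_pchar pchar5 m) e GRing.natr_mod_pchar.
wlog le : m m' e / (m <= m')%N => [H|].
  by have [/H->|/ltnW/H->] := leqP m m'.
apply/esym/eqP; rewrite eqn_mod_dvd // (dvdn_pcharf pchar5) natrB //.
by rewrite e subrr.
Qed.

Lemma Fp_natr_mod5p m : (m %% (5 * p))%:R = m%:R :> 'F_p.
Proof. by apply/eqP; rewrite Fp_natr_eq // modn_dvdm ?dvdn_mull. Qed.

Lemma natr_mod5p m : (m %% (5 * p))%:R = m%:R :> K.
Proof.
rewrite -(GRing.natr_mod_pchar pchar5 (m %% _)) modn_dvdm ?dvdn_mulr //.
exact: GRing.natr_mod_pchar.
Qed.

(** The exponents run over a full period of the generator a mod p, so each unit mod p is met as some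
    a^j, and the residue mod 5 of that power is chi(a^j). Thus S is the graph of chi on the
    units. *)
Lemma mem_Sset (x : 'I_(5 * p)) :
  (x \in S) = (x%:R != 0 :> 'F_p) && (x%:R == chi x%:R :> K).
Proof.
rewrite inE; apply/existsP/andP => [[j /eqP ->]|[x0 /eqP xK]].
  rewrite Fp_natr_mod5p natr_mod5p !natrX chiX; split=> //.
  rewrite expf_neq0 // (prim_root_eq0 aP).
  by rewrite -lt0n (prim_order_gt0 aP).
have [j lt_j xE] := Fp_dlog p_pr aP x0; rewrite -subn1 in lt_j.
exists (Ordinal lt_j) => /=; rewrite -[X in X == _](modn_small (ltn_ord x)).
by rewrite eqmod5p !natrX xK xE chiX !eqxx.
Qed.

(** Reduction mod p is injective on the graph S and maps the intersection onto the c other than 0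
    and 1 with chi(c) = chi(c - 1) + 1. As chi(-1) = -1, this is chi(c) + chi(1 - c) = 1, which also
    has the solutions c = 0 and c = 1; they account for the 2. *)
Lemma card_Sset_shift : chi (-1) = -1 ->
  (#|S :&: shift1 S| + 2)%N = #|[set x : 'F_p | chi x + chi (1 - x) == 1]|.
Proof.
move=> cN; have [c0 c1 cM] := power_char_mult p_pr aP aKn.
pose D := [set c : 'F_p | [&& c != 0, c - 1 != 0 & chi c == chi (c - 1) + 1]].
have cpl (c : 'F_p) : chi (c - 1) = - chi (1 - c).
  by rewrite -[c - 1]opprB -mulN1r cM cN mulN1r.
have -> : [set x : 'F_p | chi x + chi (1 - x) == 1] = 0 |: (1 |: D).
  apply/setP => c; rewrite !inE cpl subr_eq0.
  have [->|_] := eqVneq c 0; first by rewrite c0 subr0 c1 add0r eqxx.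
  have [->|_] := eqVneq c 1; first by rewrite c1 subrr c0 addr0 eqxx.
  by rewrite /= [- _ + 1]addrC -subr_eq opprK.
rewrite !cardsU1 !inE subrr !eqxx [0 == 1]eq_sym oner_eq0 /=.
suff -> : #|S :&: shift1 S| = #|D| by rewrite addnC.
pose pi (x : 'I_(5 * p)) : 'F_p := (x : nat)%:R.
have pi_inj : {in S :&: shift1 S &, injective pi}.
  move=> x y /setIP[xS _] /setIP[yS _].
  move: xS yS; rewrite !mem_Sset => /andP[_ /eqP xK] /andP[_ /eqP yK] e.
  apply/val_inj/eqP; rewrite /= -(modn_small (ltn_ord x)) -(modn_small (ltn_ord y)).
  by rewrite eqmod5p -/(pi x) -/(pi y) e eqxx /= xK yK -/(pi x) -/(pi y) e.
rewrite -(card_in_imset pi_inj); apply: eq_card => c.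
apply/imsetP/idP => [[x /setIP[xS]]|].
  rewrite inE => /existsP[y /andP[yS /eqP xy]] ->; rewrite inE.
  move: xS yS; rewrite !mem_Sset => /andP[x0 /eqP xK] /andP[y0 /eqP yK].
  have e : x%:R - 1 = y%:R :> 'F_p by rewrite xy Fp_natr_mod5p natrD addrK.
  by rewrite /pi e x0 y0 -xK -yK /= xy natr_mod5p natrD.
rewrite inE => /and3P[cn0 cn1 /eqP cc].
have [j _ cE] := Fp_dlog p_pr aP cn0; have [l _ c1E] := Fp_dlog p_pr aP cn1.
pose f k : 'I_(5 * p) := Ordinal (ltn_pmod (a ^ k) fp0).
have fF k : (f k)%:R = a%:R ^+ k :> 'F_p by rewrite /= Fp_natr_mod5p natrX.
have fK k : (f k)%:R = a%:R ^+ k :> K by rewrite /= natr_mod5p natrX.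
have fS k : f k \in S.
  rewrite mem_Sset fF fK chiX eqxx andbT expf_neq0 // (prim_root_eq0 aP).
  by rewrite -lt0n (prim_order_gt0 aP).
exists (f j); last by rewrite /pi fF.
rewrite inE fS inE; apply/existsP; exists (f l); rewrite fS /=.
rewrite eqmod5p natrD fF natrD fK !natrX -cE -c1E subrK eqxx /=.
by rewrite -!chiX -cE -c1E cc.
Qed.

End OrbitCount.

(** * Construction of the residue a for a suitable prime *)

Lemma generates_units_prim_root p a : prime p ->
  p.-1.-primitive_root (a%:R : 'F_p) -> generates_units_mod p a.
Proof.
move=> p_pr aP; have cop b : coprime b p = (b%:R != 0 :> 'F_p).
  by rewrite coprime_sym prime_coprime // (dvdn_pcharf (pchar_Fp p_pr)).
split; first by rewrite cop (prim_root_eq0 aP) -lt0n (prim_order_gt0 aP).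
move=> b; rewrite cop => b0; have [j _ bE] := Fp_dlog p_pr aP b0.
by exists j; apply/eqP; rewrite -Fp_natr_eq // natrX bE.
Qed.

Lemma good_generator p : prime p -> (p %% 8 = 5)%N -> (p %% 5 = 1)%N ->
    (exists r : 'F_p, r ^+ 4 = - 5%:R) ->
  exists a : nat, [/\ (a < 5 * p)%N, coprime a (5 * p),
    generates_units_mod p a,
    a ^ ((p - 1) %/ 2) + 1 = 0 %[mod 5 * p]
    & #|Sset (5 * p) a (p - 1) :&: shift1 (Sset (5 * p) a (p - 1))| + 2
        = 0 %[mod 5]]%N.
Proof.
move=> p_pr p8 p51 [r r4]; have p5 : p != 5 by apply: contra_eq_neq p51 => ->.
have odd_p : odd p by lia.
have [K [pchar5 [psi [psiD psi_nt psi0]]]] := exists_add_char p_pr p5.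
have nat5 : 5%:R = 0 :> K := natr5 pchar5.
have [g gP] := Fp_prim_root p_pr.
have n4 : p.-1 = (2 * (2 * (p.-1 %/ 4)))%N by lia.
(* As p = 5 mod 8, (p - 1) / 2 is twice an odd number, so b^2 = -1 gives b^((p-1)/2) = -1. This
   yields both chi(-1) = -1 and the required congruence mod 5. *)
have h4 : p.-1./2 = (2 * (2 * (p %/ 8)).+1)%N by lia.
have two2 : (2%:R : K) ^+ 2 = -1.
  by transitivity (5%:R - 1 : K); [ring | rewrite nat5 sub0r].
have X4 (b : K) : b ^+ 2 = -1 -> b ^+ p.-1 = 1.
  by move=> b2; rewrite n4 !exprM b2 sqrrN !expr1n.
have Xh (b : K) : b ^+ 2 = -1 -> b ^+ p.-1./2 = -1.
  by move=> b2; rewrite h4 exprM b2 exprS exprM sqrrN !expr1n mulr1.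
pose chi := power_char p.-1 (g%:R : 'F_p) (2%:R : K).
have chiM : mult_char chi := power_char_mult p_pr gP (X4 _ two2).
have chiX k : chi (g%:R ^+ k) = 2%:R ^+ k := power_charX gP (X4 _ two2) k.
have charN1 (c : 'F_p) (b : K) : p.-1.-primitive_root c -> b ^+ 2 = -1 ->
    power_char p.-1 c b (-1) = -1.
  move=> cP b2; rewrite -(Fp_prim_rootN1 p_pr cP odd_p).
  by rewrite (power_charX cP) ?X4 // Xh.
have chiP : quartic_char chi.
  split=> //; [|exact: charN1|].
    move=> x x0; have [j _ ->] := Fp_dlog p_pr gP x0; rewrite chiX -exprM mulnC exprM.
    by rewrite (exprM _ 2 2) two2 sqrrN !expr1n.
  exists g%:R; last by rewrite -[g%:R]expr1 chiX expr1.
  by rewrite (prim_root_eq0 gP) -lt0n (prim_order_gt0 gP).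
have chi5 : chi 5%:R = -1.
  have [c0 c1 cM] := chiM; have [_ c4 cN _] := chiP.
  have r0 : r != 0.
    apply: contra_eq_neq r4 => ->; rewrite expr0n eq_sym oppr_eq0.
    by rewrite -(dvdn_pcharf (pchar_Fp p_pr)) dvdn_prime2.
  (* Hence chi(5) = chi(-1) chi(r)^4 = -1. *)
  have -> : 5%:R = -1 * (r * (r * (r * r))) :> 'F_p.
    by rewrite -[r * _]/(r ^+ 4) r4 mulN1r opprK.
  by rewrite !cM cN -[chi r * (_ * _)]/(chi r ^+ 4) (c4 r r0) mulr1.
have cardF1 : #|'F_p|%:R = 1 :> K.
  by rewrite card_Fp // -(GRing.natr_mod_pchar pchar5) p51.
have [k k13 cnt] :=
  exists_card_quartic_sum1 pchar5 psiD psi_nt psi0 cardF1 chiP chi5.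
have co5p : coprime 5 p by rewrite prime_coprime // dvdn_prime2 // eq_sym.
(* With a = g mod p and a = 2^k mod 5, the character attached to [a] sends g to 2^k, so it is chi^k,
   the one for which the count vanishes mod 5. *)
pose a := (chinese 5 p (2 ^ k) g %% (5 * p))%N.
have aF : a%:R = g%:R :> 'F_p.
  by rewrite Fp_natr_mod5p //; apply/eqP; rewrite Fp_natr_eq // chinese_modr.
have aK : a%:R = 2%:R ^+ k :> K.
  rewrite (natr_mod5p p pchar5) -natrX -(GRing.natr_mod_pchar pchar5) chinese_modl //.
  exact: GRing.natr_mod_pchar.
have aP : p.-1.-primitive_root (a%:R : 'F_p) by rewrite aF.
have aK2 : (a%:R : K) ^+ 2 = -1.
  rewrite aK exprAC two2 -signr_odd.
  by move: k13; rewrite !inE => /orP[]/eqP->.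
have gen := generates_units_prim_root p_pr aP.
exists a; split=> //.
- by rewrite ltn_mod muln_gt0 /= prime_gt0.
- rewrite coprimeMr (proj1 gen) andbT coprime_sym prime_coprime //.
  rewrite (dvdn_pcharf pchar5); apply: contra_eq_neq aK2 => ->.
  by rewrite expr0n eq_sym oppr_eq0 oner_neq0.
- apply/eqP; rewrite (eqmod5p p_pr p5 pchar5) !natrD !natrX.
  rewrite (_ : ((p - 1) %/ 2 = p.-1./2)%N); last by lia.
  by rewrite Fp_prim_rootN1 // Xh // !addNr !eqxx.
have aKn := X4 _ aK2.
rewrite (card_Sset_shift p_pr p5 pchar5 aP aKn); last exact: charN1.
apply/eqP; rewrite mod0n -/(dvdn _ _) (dvdn_pcharf pchar5).
rewrite -[X in _ == X]cnt; apply/eqP; congr (_%:R); apply: eq_card => x; rewrite !inE.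
have E (y : 'F_p) : power_char p.-1 (a%:R : 'F_p) (a%:R : K) y = chi y ^+ k.
  have [->|y0] := eqVneq y 0.
    rewrite power_char0 // (_ : chi 0 = 0) ?expr0n; last exact: power_char0.
    by move: k13; rewrite !inE => /orP[]/eqP->.
  have [j _ ->] := Fp_dlog p_pr gP y0.
  by rewrite -{1}aF (power_charX aP aKn) aK chiX exprAC.
by rewrite !E.
Qed.

Local Close Scope ring_scope.

Theorem mainTheorem13 :
  forall N : nat, exists p : nat, N < p /\ prime p /\
    exists a : nat,
      [/\ a < 5 * p, coprime a (5 * p),
          generates_units_mod p a,
          a ^ ((p - 1) %/ 2) + 1 = 0 %[mod 5 * p] &
          #|Sset (5 * p) a (p - 1) :&: shift1 (Sset (5 * p) a (p - 1))| + 2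
            = 0 %[mod 5]].
Proof.
move=> N; have [p [Np p_pr p8 p5 r4]] := infinitely_many_primes_quartic_N5 N.
by exists p; split=> //; split=> //; apply: good_generator.
Qed.
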